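(* Let $m,n\ge2$, $\lambda>0$, let $P^*=S_\lambda(C,a,b)$ for some $C\in\mathbb{R}^{m\times n}$ and strictly positive $a\in\Delta_m,b\in\Delta_n$, and let $P^{(\tau)}\in\mathbb{R}^{m\times n}$ (e.g. the output of $\tau$ Sinkhorn iterations). Let $L:\mathbb{R}^{m\times n}\to\mathbb{R}$ be twice continuously differentiable. Let $\sigma_+,\sigma_-,C_1,C_2,\epsilon>0$ be such that $\|P^*-P^{(\tau)}\|_F<\epsilon$ and, for every $P$ with $\|P-P^*\|_F<\epsilon$: $\min_{i,j}P_{i,j}\ge\sigma_-$, $\max_{i,j}P_{i,j}\le\sigma_+$, $\|\nabla L(P)\|_2\le C_1$ and $\|\nabla^2L(P)\|_F\le C_2$. Let $\kappa=\|\tilde E^\dagger\|_2$ where $\tilde E^\dagger$ is the Moore–Penrose pseudoinverse. For entrywise positive $P$ with $p=\mathrm{vec}(P)$, $D=\mathrm{diag}(p)$, $g(P)=\mathrm{vec}(\nabla L(P))$, define $$g_{ab}(P):=\bigl(\tilde E^\top D\tilde E\bigr)^{-1}\tilde E^\top D\,g(P)\in\mathbb{R}^{m+n-1},\qquad g_C(P):=-\lambda^{-1}\bigl(D\,g(P)-D\tilde E\,g_{ab}(P)\bigr)\in\mathbb{R}^{mn}.$$ Then $$\|g_{ab}(P^* )-g_{ab}(P^{(\tau)})\|_2\le\kappa\sqrt{\frac{\sigma_+}{\sigma_-}}\Bigl(\frac{C_1}{\sigma_-}+C_2\Bigr)\|P^*-P^{(\tau)}\|_F,$$ $$\|g_C(P^*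 )-g_C(P^{(\tau)})\|_2\le\lambda^{-1}\sigma_+\Bigl(\frac{C_1}{\sigma_-}+C_2\Bigr)\|P^*-P^{(\tau)}\|_F.$$
   Context: $\Delta_m=\{a\in\mathbb{R}^m: a_i\ge 0,\ \sum_i a_i=1\}$; $\Pi(a,b)=\{P\ge0: P\mathbb{1}_n=a,\ P^\top\mathbb{1}_m=b\}$; $h(P)=-\sum_{i,j}P_{i,j}(\log P_{i,j}-1)$; $S_\lambda(C,a,b)=\arg\min_{P\in\Pi(a,b)}\langle P,C\rangle_F-\lambda h(P)$. Vectorization is column-major ($\mathrm{vec}(X)_{(j-1)m+i}=X_{i,j}$). $E=[\mathbb{1}_n\otimes I_m,\ I_n\otimes\mathbb{1}_m]\in\mathbb{R}^{mn\times(m+n)}$ and $\tilde E$ is $E$ with its last column deleted. The Hessian $\nabla^2 L(P)$ is taken with respect to $\mathrm{vec}(P)$. For $P\in\Pi(a,b)$ entrywise positive, $g_{ab}(P)$ equals $[\nabla_a\ell;\nabla_{\tilde b}\ell]$ and $g_C(P)$ equals $\mathrm{vec}(\nabla_C\ell)$ as computed by the implicit backward pass (Algorithm 1, in which $\tilde E^\top D\tilde E=\begin{bmatrix}\mathrm{diag}(P\mathbb{1}_n)&P_{:,1:n-1}\\P_{:,1:n-1}^\top&\mathrm{diag}(P_{:,1:n-1}^\top\mathbb{1}_m)\end{bmatrix}$); the gradient with respect to $b$ is $[g_{\tilde b};0]$, so the same bound holds for the full $[a;b]$-gradient. *)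

(* Defs.v *)
From HB Require Import structures.
From mathcomp Require Import all_boot all_order all_algebra.
From mathcomp Require Import all_classical all_reals all_analysis.
Set Implicit Arguments. Unset Strict Implicit. Unset Printing Implicit Defensive.
Import Order.TTheory GRing.Theory Num.Theory.
Import numFieldNormedType.Exports.
Local Open Scope classical_set_scope.
Local Open Scope ring_scope.

Section Defs.
Variable R : realType.

Definition frob (p q : nat) (X : 'M[R]_(p, q)) : R :=
  Num.sqrt (\sum_(i < p) \sum_(j < q) X i j ^+ 2).
Definition vnorm2 (k : nat) (v : 'cV[R]_k) : R := frob v.

Definition opnorm2 (p q : nat) (X : 'M[R]_(p, q)) : R :=
  sup [set vnorm2 (X *m v) | v in [set v : 'cV[R]_q | vnorm2 v = 1]].

(* Moore-Penrose conditions (real case); the pseudoinverse is unique. *)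
Definition is_MP_pinv (p q : nat) (A : 'M[R]_(p, q)) (X : 'M[R]_(q, p)) : Prop :=
  [/\ A *m X *m A = A, X *m A *m X = X,
      (A *m X)^T = A *m X & (X *m A)^T = X *m A].

Variables m n : nat.

(* column-major vectorization: vec X _{(j-1)m+i} = X_{i,j} (0-based: j*m+i) *)
Definition vec (X : 'M[R]_(m, n)) : 'cV[R]_(n * m) := (mxvec X^T)^T.
Definition unvec (v : 'cV[R]_(n * m)) : 'M[R]_(m, n) := (vec_mx v^T)^T.
Definition ebasis (r : 'I_(n * m)) : 'M[R]_(m, n) := unvec (delta_mx r 0).

(* E = [1_n (x) I_m, I_n (x) 1_m] in R^{mn x (m+n)}: row r = (j-1)m+i
   (0-based r = j*m+i) has a 1 in column i and in column m+j. *)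
Definition Emx : 'M[R]_(n * m, m + n) :=
  \matrix_(r, c) (((c < m) && (r %% m == c)) || ((m <= c) && (r %/ m == c - m)))%N%:R.
Lemma Etil_le : (m + n.-1 <= m + n)%N.
Proof. by rewrite leq_add2l leq_pred. Qed.
Definition Etil : 'M[R]_(n * m, m + n.-1) :=
  \matrix_(r, c) Emx r (widen_ord Etil_le c).

Definition transport_poly (a : 'cV[R]_m) (b : 'cV[R]_n) (P : 'M[R]_(m, n)) : Prop :=
  (forall i j, 0 <= P i j) /\ P *m const_mx 1 = a /\ P^T *m const_mx 1 = b.
Definition entropy (P : 'M[R]_(m, n)) : R :=
  - \sum_(i < m) \sum_(j < n) P i j * (ln (P i j) - 1).
Definition frob_inner (P C : 'M[R]_(m, n)) : R :=
  \sum_(i < m) \sum_(j < n) P i j * C i j.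
Definition is_sinkhorn_sol (lam : R) (C : 'M[R]_(m, n)) (a : 'cV[R]_m) (b : 'cV[R]_n)
    (P : 'M[R]_(m, n)) : Prop :=
  transport_poly a b P /\
  forall Q, transport_poly a b Q ->
    frob_inner P C - lam * entropy P <= frob_inner Q C - lam * entropy Q.

Definition in_simplex (k : nat) (a : 'cV[R]_k) : Prop :=
  (forall i, 0 <= a i 0) /\ \sum_(i < k) a i 0 = 1.

Definition gradL (L : 'M[R]_(m, n) -> R) (P : 'M[R]_(m, n)) : 'M[R]_(m, n) :=
  \matrix_(i, j) 'D_(delta_mx i j) L P.
Definition hessL (L : 'M[R]_(m, n) -> R) (P : 'M[R]_(m, n)) : 'M[R]_(n * m) :=
  \matrix_(r, s) 'D_(ebasis s) ('D_(ebasis r) L) P.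

Definition is_C2 (L : 'M[R]_(m, n) -> R) : Prop :=
  [/\ continuous L,
      forall r P, derivable L P (ebasis r),
      forall r, continuous ('D_(ebasis r) L),
      forall r s P, derivable ('D_(ebasis r) L) P (ebasis s) &
      forall r s, continuous ('D_(ebasis s) ('D_(ebasis r) L))].

Definition gvec (L : 'M[R]_(m, n) -> R) (P : 'M[R]_(m, n)) : 'cV[R]_(n * m) :=
  vec (gradL L P).
Definition Dmx (P : 'M[R]_(m, n)) : 'M[R]_(n * m) := diag_mx (vec P)^T.

Definition g_ab (L : 'M[R]_(m, n) -> R) (P : 'M[R]_(m, n)) : 'cV[R]_(m + n.-1) :=
  invmx (Etil^T *m Dmx P *m Etil) *m (Etil^T *m Dmx P *m gvec L P).
Definition g_C (lam : R) (L : 'M[R]_(m, n) -> R) (P : 'M[R]_(m, n)) : 'cV[R]_(n * m) :=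
  - lam^-1 *: (Dmx P *m gvec L P - Dmx P *m Etil *m g_ab L P).

End Defs.

(* Main.v *)
Require Import Defs.
From HB Require Import structures.
From mathcomp Require Import all_boot all_order all_algebra.
From mathcomp Require Import all_classical all_reals all_analysis.
From mathcomp Require Import ring lra.
Import Order.TTheory GRing.Theory Num.Theory.
Import numFieldNormedType.Exports.
Local Open Scope classical_set_scope.
Local Open Scope ring_scope.
Set Implicit Arguments.
Unset Strict Implicit.
Unset Printing Implicit Defensive.

(* [g_ab L P] is the weighted least-squares solution x_P of E x ~ g_P with weights
   p = vec P, and [g_C] is -lam^-1 D_P r_P for its residual r_P = g_P - E x_P.
   No derivative of [g_ab] is needed: x_P - x_Q is exactly the least-squares
   solution, for the weights p, of the right-hand side
     w = (g_P - g_Q) + D_P^-1 (D_P - D_Q) r_Q,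
   and D_P r_P - D_Q r_Q = D_P (w - E (x_P - x_Q)).  As the fit and the residual of w
   are orthogonal for the p-weighted inner product, both are bounded by the
   p-weighted norm of w.  The term g_P - g_Q is controlled by the Hessian
   through the mean value theorem along the segment [Q, P]. *)

(** * Norms and Cauchy-Schwarz *)

Lemma cauchy_schwarz_sum (R : realType) (I : finType) (u v : I -> R) :
  (\sum_i u i * v i) ^+ 2 <= (\sum_i u i ^+ 2) * (\sum_i v i ^+ 2).
Proof.
(* Lagrange's identity *)
rewrite -subr_ge0.
have -> : (\sum_i u i ^+ 2) * (\sum_i v i ^+ 2) - (\sum_i u i * v i) ^+ 2
    = 2^-1 * \sum_i \sum_j (u i * v j - u j * v i) ^+ 2.
  under [in RHS]eq_bigr => i _.
    under eq_bigr => j _.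
      rewrite (_ : (_ ^+ 2) = u i ^+ 2 * v j ^+ 2 + u j ^+ 2 * v i ^+ 2
        - 2 * ((u i * v i) * (u j * v j))); last by ring.
      over.
    rewrite sumrB big_split /= -!mulr_sumr -mulr_suml; over.
  rewrite sumrB big_split /= -!mulr_suml -!mulr_sumr.
  by rewrite -mulr_suml; field.
by rewrite mulr_ge0 ?invr_ge0//; do 2 (apply: sumr_ge0 => ? _); exact: sqr_ge0.
Qed.

Section norms.
Variable R : realType.

Lemma frob_ge0 (p q : nat) (X : 'M[R]_(p, q)) : 0 <= frob X.
Proof. exact: sqrtr_ge0. Qed.

Lemma sqr_frob (p q : nat) (X : 'M[R]_(p, q)) :
  frob X ^+ 2 = \sum_(i < p) \sum_(j < q) X i j ^+ 2.
Proof.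
by rewrite sqr_sqrtr//; do 2 (apply: sumr_ge0 => ? _); exact: sqr_ge0.
Qed.

Lemma frob_trmx (p q : nat) (X : 'M[R]_(p, q)) : frob X^T = frob X.
Proof.
rewrite /frob exchange_big /=; congr (Num.sqrt _).
by apply: eq_bigr => i _; apply: eq_bigr => j _; rewrite mxE.
Qed.

Lemma frobZ (p q : nat) (c : R) (X : 'M[R]_(p, q)) : frob (c *: X) = `|c| * frob X.
Proof.
rewrite /frob -sqrtr_sqr -sqrtrM ?sqr_ge0//; congr (Num.sqrt _).
rewrite mulr_sumr; apply: eq_bigr => i _; rewrite mulr_sumr; apply: eq_bigr => j _.
by rewrite mxE exprMn.
Qed.

Lemma frobBC (p q : nat) (X Y : 'M[R]_(p, q)) : frob (X - Y) = frob (Y - X).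
Proof. by rewrite -opprB -scaleN1r frobZ normrN1 mul1r. Qed.

Lemma frob_eq0 (p q : nat) (X : 'M[R]_(p, q)) : frob X = 0 -> X = 0.
Proof.
move=> X0; have /eqP : frob X ^+ 2 = 0 by rewrite X0 expr0n.
rewrite sqr_frob psumr_eq0 => [/allP XP|i _]; last first.
  by apply: sumr_ge0 => ? _; exact: sqr_ge0.
apply/matrixP => i j; rewrite mxE.
have /= := XP i (mem_index_enum _); rewrite psumr_eq0 => [/allP|? _]; last exact: sqr_ge0.
by move=> /(_ j (mem_index_enum _)) /=; rewrite sqrf_eq0 => /eqP.
Qed.

Lemma sqr_vnorm2 (k : nat) (v : 'cV[R]_k) : vnorm2 v ^+ 2 = \sum_i v i 0 ^+ 2.
Proof. by rewrite sqr_frob; apply: eq_bigr => i _; rewrite big_ord1. Qed.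

Lemma vnorm2_dot_le (k : nat) (u v : 'cV[R]_k) :
  `|\sum_i u i 0 * v i 0| <= vnorm2 u * vnorm2 v.
Proof.
rewrite -(@ler_pXn2r _ 2)// ?nnegrE ?mulr_ge0 ?frob_ge0//.
by rewrite real_normK ?num_real// exprMn !sqr_vnorm2 cauchy_schwarz_sum.
Qed.

Lemma vnorm2_triangle (k : nat) (u v : 'cV[R]_k) :
  vnorm2 (u + v) <= vnorm2 u + vnorm2 v.
Proof.
rewrite -(@ler_pXn2r _ 2)// ?nnegrE ?addr_ge0 ?frob_ge0//.
rewrite sqr_vnorm2 sqrrD !sqr_vnorm2.
under eq_bigr => i _ do rewrite mxE sqrrD.
rewrite !big_split /= lerD2r lerD2l -mulr2n lerMn2r /=.
apply: le_trans (ler_norm _) _; exact: vnorm2_dot_le.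
Qed.

Lemma vnorm2_mulmx (p q : nat) (A : 'M[R]_(p, q)) (v : 'cV[R]_q) :
  vnorm2 (A *m v) <= frob A * vnorm2 v.
Proof.
rewrite -(@ler_pXn2r _ 2)// ?nnegrE ?mulr_ge0 ?frob_ge0//.
rewrite exprMn sqr_vnorm2 sqr_frob mulr_suml; apply: ler_sum => i _.
rewrite mxE sqr_vnorm2; exact: cauchy_schwarz_sum.
Qed.

(** The Cauchy-Schwarz bound by [frob A] keeps the set under [sup] bounded above, so the supremum is
    an upper bound; it is applied to [v] normalised. *)
Lemma vnorm2_mulmx_opnorm2 (p q : nat) (A : 'M[R]_(p, q)) (v : 'cV[R]_q) :
  vnorm2 (A *m v) <= opnorm2 A * vnorm2 v.
Proof.
have [/frob_eq0 ->|v0] := eqVneq (vnorm2 v) 0.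
  have := vnorm2_mulmx A 0; rewrite mulmx0.
  have -> : vnorm2 (0 : 'cV[R]_q) = 0 by rewrite -(scale0r 0) /vnorm2 frobZ normr0 mul0r.
  by rewrite !mulr0.
have vp : 0 < vnorm2 v by rewrite lt_def v0 frob_ge0.
rewrite -ler_pdivrMr//.
have -> : vnorm2 (A *m v) / vnorm2 v = vnorm2 (A *m ((vnorm2 v)^-1 *: v)).
  by rewrite -scalemxAr /vnorm2 frobZ ger0_norm ?invr_ge0 ?frob_ge0// mulrC.
apply: ub_le_sup.
  exists (frob A) => _ [w /= w1 <-].
  by apply: le_trans (vnorm2_mulmx _ _) _; rewrite w1 mulr1.
exists ((vnorm2 v)^-1 *: v) => //=.
by rewrite /vnorm2 frobZ ger0_norm ?invr_ge0 ?frob_ge0// mulVf.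
Qed.

Lemma opnorm2_ge0 (p q : nat) (A : 'M[R]_(p, q)) : 0 <= opnorm2 A.
Proof.
rewrite /opnorm2; set S := [set _ | _ in _].
(* For [q = 0] there is no unit vector, and [sup] of the empty set is 0 by convention. *)
have [->|/set0P[_ [v v1 _]]] := eqVneq S set0; first by rewrite sup0.
apply: le_trans (frob_ge0 (A *m v)) _.
apply: ub_le_sup; last by exists v.
exists (frob A) => _ [w /= w1 <-].
by apply: le_trans (vnorm2_mulmx _ _) _; rewrite w1 mulr1.
Qed.

(** Norm of the inner product with weights [p]; the square roots reduce its triangle inequality to
    the Euclidean one. *)
Definition wnorm (k : nat) (p v : 'cV[R]_k) : R :=
  vnorm2 (\col_i (Num.sqrt (p i 0) * v i 0)).

Lemma wnorm_ge0 (k : nat) (p v : 'cV[R]_k) : 0 <= wnorm p v.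
Proof. exact: frob_ge0. Qed.

Lemma wnormD (k : nat) (p u v : 'cV[R]_k) : wnorm p (u + v) <= wnorm p u + wnorm p v.
Proof.
rewrite /wnorm (_ : \col_i _ = \col_i (Num.sqrt (p i 0) * u i 0)
  + \col_i (Num.sqrt (p i 0) * v i 0)); first exact: vnorm2_triangle.
by apply/colP => i; rewrite !mxE mulrDr.
Qed.

Lemma sqr_wnorm (k : nat) (p v : 'cV[R]_k) : (forall i, 0 <= p i 0) ->
  wnorm p v ^+ 2 = \sum_i p i 0 * v i 0 ^+ 2.
Proof.
move=> p0; rewrite sqr_vnorm2; apply: eq_bigr => i _.
by rewrite mxE exprMn sqr_sqrtr.
Qed.

Lemma wnorm_le (k : nat) (p v : 'cV[R]_k) (c : R) :
  (forall i, 0 <= p i 0) -> (forall i, p i 0 <= c) -> 0 <= c ->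
  wnorm p v <= Num.sqrt c * vnorm2 v.
Proof.
move=> p0 pc c0.
rewrite -(@ler_pXn2r _ 2)// ?nnegrE ?wnorm_ge0 ?mulr_ge0 ?frob_ge0 ?sqrtr_ge0//.
rewrite sqr_wnorm// exprMn sqr_sqrtr// sqr_vnorm2 mulr_sumr.
by apply: ler_sum => i _; rewrite ler_wpM2r ?sqr_ge0.
Qed.

Lemma wnorm_ge (k : nat) (p v : 'cV[R]_k) (c : R) :
  0 <= c -> (forall i, c <= p i 0) -> Num.sqrt c * vnorm2 v <= wnorm p v.
Proof.
move=> c0 pc; have p0 i : 0 <= p i 0 by exact: le_trans c0 _.
rewrite -(@ler_pXn2r _ 2)// ?nnegrE ?wnorm_ge0 ?mulr_ge0 ?frob_ge0 ?sqrtr_ge0//.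
rewrite sqr_wnorm// exprMn sqr_sqrtr// sqr_vnorm2 mulr_sumr.
by apply: ler_sum => i _; rewrite ler_wpM2r ?sqr_ge0.
Qed.

Lemma diag_mulE (k : nat) (p v : 'cV[R]_k) i :
  (diag_mx p^T *m v) i 0 = p i 0 * v i 0.
Proof. by rewrite mul_diag_mx !mxE. Qed.

(** Of the two factors [p i 0] in the square, one stays as the weight and only the other is bounded
    by [c], hence [Num.sqrt c]. *)
Lemma vnorm2_diag_wnorm (k : nat) (p v : 'cV[R]_k) (c : R) :
  (forall i, 0 <= p i 0) -> (forall i, p i 0 <= c) -> 0 <= c ->
  vnorm2 (diag_mx p^T *m v) <= Num.sqrt c * wnorm p v.
Proof.
move=> p0 pc c0.
rewrite -(@ler_pXn2r _ 2)// ?nnegrE ?mulr_ge0 ?frob_ge0 ?sqrtr_ge0//.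
rewrite exprMn (@sqr_sqrtr _ c)// sqr_wnorm// sqr_vnorm2 mulr_sumr.
apply: ler_sum => i _; rewrite diag_mulE exprMn expr2 -mulrA.
by rewrite ler_wpM2r// mulr_ge0 ?sqr_ge0.
Qed.

(** Changes the weights from [p] to [q], so that a residual for [q] is measured in its own norm. One
    factor [1 / c] bounds the inverse of [p i 0], the other comes from [1 <= q i 0 / c]. *)
Lemma wnorm_reweight (k : nat) (p q r : 'cV[R]_k) (c : R) :
  0 < c -> (forall i, c <= p i 0) -> (forall i, c <= q i 0) ->
  wnorm p (\col_i ((p i 0)^-1 * (p i 0 - q i 0) * r i 0))
    <= vnorm2 (p - q) / c * wnorm q r.
Proof.
move=> c0 pc qc.
have p0 i : 0 < p i 0 by exact: lt_le_trans c0 _.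
have q0 i : 0 < q i 0 by exact: lt_le_trans c0 _.
rewrite -(@ler_pXn2r _ 2)// ?nnegrE ?mulr_ge0 ?invr_ge0 ?frob_ge0 ?(ltW c0)//.
have p0' i : 0 <= p i 0 by exact: ltW.
have q0' i : 0 <= q i 0 by exact: ltW.
rewrite exprMn !sqr_wnorm// mulr_sumr.
apply: ler_sum => i _; rewrite mxE.
have -> : p i 0 * ((p i 0)^-1 * (p i 0 - q i 0) * r i 0) ^+ 2
  = (p i 0)^-1 * ((p i 0 - q i 0) ^+ 2 * r i 0 ^+ 2).
  by field; rewrite gt_eqF.
have -> : (vnorm2 (p - q) / c) ^+ 2 * (q i 0 * r i 0 ^+ 2)
  = (c ^-1 * (q i 0 / c)) * (vnorm2 (p - q) ^+ 2 * r i 0 ^+ 2).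
  by field; rewrite gt_eqF.
apply: ler_pM.
- by rewrite invr_ge0.
- by apply: mulr_ge0; exact: sqr_ge0.
- rewrite -[leLHS]mulr1; apply: ler_pM => //; rewrite ?invr_ge0//.
    by rewrite lef_pV2 ?posrE.
  by rewrite ler_pdivlMr// mul1r.
rewrite ler_wpM2r ?sqr_ge0// sqr_vnorm2 (bigD1 i)//= !mxE lerDl.
by apply: sumr_ge0 => j _; exact: sqr_ge0.
Qed.

End norms.

(** * Weighted least squares *)

Section weighted_least_squares.
Variables (R : realType) (N k : nat) (E : 'M[R]_(N, k)).
Hypothesis E_inj : forall x : 'cV_k, E *m x = 0 -> x = 0.

(** Has the shape of [g_ab] with [E], weights and data abstract, so that [g_ab] is an instance by
    conversion. *)
Definition wls (p g : 'cV[R]_N) : 'cV[R]_k :=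
  invmx (E^T *m diag_mx p^T *m E) *m (E^T *m diag_mx p^T *m g).

(** A kernel vector x satisfies 0 = x^T E^T D E x, a sum of terms p_i (E x)_i^2; hence E x = 0, and
    x = 0 by injectivity. *)
Lemma wls_unitmx (p : 'cV[R]_N) : (forall i, 0 < p i 0) ->
  E^T *m diag_mx p^T *m E \in unitmx.
Proof.
move=> p0; rewrite -unitmx_tr -row_free_unit; apply: inj_row_free => v v0.
apply: trmx_inj; rewrite trmx0; apply: E_inj; apply/frob_eq0.
have {}v0 : E^T *m diag_mx p^T *m E *m v^T = 0.
  by apply: trmx_inj; rewrite trmx_mul trmxK v0 trmx0.
have S0 : \sum_i p i 0 * (E *m v^T) i 0 ^+ 2 = 0.
  transitivity ((v *m (E^T *m diag_mx p^T *m E *m v^T)) 0 0); last first.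
    by rewrite v0 mulmx0 mxE.
  have -> : v *m (E^T *m diag_mx p^T *m E *m v^T)
    = (E *m v^T)^T *m (diag_mx p^T *m (E *m v^T)).
    by rewrite trmx_mul trmxK !mulmxA.
  rewrite mxE.
  by apply: eq_bigr => i _; rewrite diag_mulE [X in _ = X * _]mxE expr2 mulrCA.
move: S0 => /eqP; rewrite psumr_eq0 => [/allP S0|i _]; last first.
  by rewrite mulr_ge0 ?sqr_ge0// ltW.
suff -> : E *m v^T = 0 by rewrite -(scale0r 0) frobZ normr0 mul0r.
apply/colP => i; rewrite [RHS]mxE.
have := S0 i (mem_index_enum _); rewrite /= mulf_eq0 gt_eqF//= sqrf_eq0.
by move/eqP.
Qed.

Lemma wls_normal (p g : 'cV[R]_N) : (forall i, 0 < p i 0) ->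
  E^T *m (diag_mx p^T *m (g - E *m wls p g)) = 0.
Proof.
move=> p0; rewrite mulmxA mulmxBr mulmxA /wls mulmxA mulmxV ?wls_unitmx//.
by rewrite mul1mx subrr.
Qed.

Lemma wls_unique (p g : 'cV[R]_N) x : (forall i, 0 < p i 0) ->
  E^T *m (diag_mx p^T *m (g - E *m x)) = 0 -> x = wls p g.
Proof.
move=> p0; rewrite mulmxA mulmxBr mulmxA => /subr0_eq.
by rewrite /wls => ->; rewrite mulKmx// wls_unitmx.
Qed.

(** By the normal equations the residual is orthogonal to the range of [E] for the [p]-weighted
    inner product, so the cross term vanishes. *)
Lemma wls_pythagoras (p g : 'cV[R]_N) : (forall i, 0 < p i 0) ->
  wnorm p g ^+ 2 =
    wnorm p (E *m wls p g) ^+ 2 + wnorm p (g - E *m wls p g) ^+ 2.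
Proof.
move=> p0; have p0' i : 0 <= p i 0 by rewrite ltW.
set u := E *m _; set r := g - u; rewrite !sqr_wnorm//.
have ur : \sum_i p i 0 * (u i 0 * r i 0) = 0.
  transitivity (((wls p g)^T *m (E^T *m (diag_mx p^T *m r))) 0 0); last first.
    by rewrite wls_normal// mulmx0 mxE.
  rewrite mulmxA -trmx_mul mxE; apply: eq_bigr => i _.
  by rewrite diag_mulE [X in _ = X * _]mxE mulrCA.
have -> : \sum_i p i 0 * g i 0 ^+ 2 = \sum_i p i 0 * u i 0 ^+ 2
    + \sum_i p i 0 * r i 0 ^+ 2 + 2 * \sum_i p i 0 * (u i 0 * r i 0).
  rewrite mulr_sumr -!big_split /=; apply: eq_bigr => i _.
  have -> : g i 0 = u i 0 + r i 0 by rewrite [r i 0]mxE [X in _ + (_ + X)]mxE addrC subrK.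
  by ring.
by rewrite ur mulr0 addr0.
Qed.

Lemma wnorm_wls_le (p g : 'cV[R]_N) : (forall i, 0 < p i 0) ->
  wnorm p (E *m wls p g) <= wnorm p g.
Proof.
move=> p0; rewrite -(@ler_pXn2r _ 2)// ?nnegrE ?wnorm_ge0//.
by rewrite [leRHS]wls_pythagoras// lerDl sqr_ge0.
Qed.

Lemma wnorm_wls_residual_le (p g : 'cV[R]_N) : (forall i, 0 < p i 0) ->
  wnorm p (g - E *m wls p g) <= wnorm p g.
Proof.
move=> p0; rewrite -(@ler_pXn2r _ 2)// ?nnegrE ?wnorm_ge0//.
by rewrite [leRHS]wls_pythagoras// lerDr sqr_ge0.
Qed.

(* The right-hand side w of the header. *)
Definition wls_perturbation (p q g h : 'cV[R]_N) : 'cV[R]_N :=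
  g - h + \col_i ((p i 0)^-1 * (p i 0 - q i 0) * (h - E *m wls q h) i 0).

(** D_p cancels the inverse weights in the perturbation, and with r = h - E x_q one has g - h + r =
    g - E x_q. *)
Lemma diag_wls_perturbation (p q g h : 'cV[R]_N) : (forall i, 0 < p i 0) ->
  diag_mx p^T *m wls_perturbation p q g h =
  diag_mx p^T *m (g - E *m wls q h) - diag_mx q^T *m (h - E *m wls q h).
Proof.
move=> p0; rewrite /wls_perturbation; set r := h - _.
rewrite mulmxDr.
have -> : diag_mx p^T *m (\col_i ((p i 0)^-1 * (p i 0 - q i 0) * r i 0))
    = diag_mx p^T *m r - diag_mx q^T *m r.
  apply/colP => i; rewrite diag_mulE mxE [RHS]mxE [X in _ = _ + X]mxE !diag_mulE.
  by field; rewrite gt_eqF.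
by rewrite addrA -mulmxDr /r addrA subrK.
Qed.

(** Serves both bounds: its left side is killed by [E^T], which identifies the difference of the
    solutions, and is also the difference of the [g_C] up to the factor [- lam^-1]. *)
Lemma diag_residualB (p q g h : 'cV[R]_N) : (forall i, 0 < p i 0) ->
  diag_mx p^T *m (g - E *m wls p g) - diag_mx q^T *m (h - E *m wls q h) =
  diag_mx p^T *m (wls_perturbation p q g h - E *m (wls p g - wls q h)).
Proof.
move=> p0; rewrite [RHS]mulmxBr diag_wls_perturbation// addrAC -mulmxBr.
by rewrite [E *m (_ - _)]mulmxBr opprB addrA subrK.
Qed.

(** The normal equations for [p] and for [q] give those of the perturbation, whose solution is
    unique. *)
Lemma wlsB (p q g h : 'cV[R]_N) :
  (forall i, 0 < p i 0) -> (forall i, 0 < q i 0) ->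
  wls p g - wls q h = wls p (wls_perturbation p q g h).
Proof.
move=> p0 q0; apply: wls_unique => //.
by rewrite -diag_residualB// mulmxBr !wls_normal// subr0.
Qed.

(** * Lipschitz dependence of the solution and residual on weights and data *)

Section bounds.
Variables (sm sp C1 C2 : R) (p q g h : 'cV[R]_N).
Hypotheses (sm0 : 0 < sm) (sp0 : 0 < sp).
Hypotheses (psm : forall i, sm <= p i 0) (psp : forall i, p i 0 <= sp).
Hypotheses (qsm : forall i, sm <= q i 0) (qsp : forall i, q i 0 <= sp).
Hypothesis hC1 : vnorm2 h <= C1.
Hypothesis ghC2 : vnorm2 (g - h) <= C2 * vnorm2 (p - q).

Let p0 i : 0 < p i 0. Proof. exact: lt_le_trans sm0 _. Qed.
Let q0 i : 0 < q i 0. Proof. exact: lt_le_trans sm0 _. Qed.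

(** The data term [g - h] gives [C2]. The reweighted term gives [C1 / sm], because the residual for
    [q] is no larger than [h] in the [q]-weighted norm. *)
Lemma wnorm_wls_perturbation :
  wnorm p (wls_perturbation p q g h)
    <= Num.sqrt sp * ((C1 / sm + C2) * vnorm2 (p - q)).
Proof.
have p0' i : 0 <= p i 0 by exact: ltW.
have q0' i : 0 <= q i 0 by exact: ltW.
apply: le_trans (wnormD _ _ _) _.
have -> : Num.sqrt sp * ((C1 / sm + C2) * vnorm2 (p - q))
  = Num.sqrt sp * (C2 * vnorm2 (p - q))
    + vnorm2 (p - q) / sm * (Num.sqrt sp * C1) by ring.
apply: lerD.
  apply: le_trans (wnorm_le _ p0' psp (ltW sp0)) _.
  by rewrite ler_wpM2l ?sqrtr_ge0.
apply: le_trans (wnorm_reweight _ sm0 psm qsm) _.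
rewrite ler_wpM2l ?divr_ge0 ?frob_ge0 ?(ltW sm0)//.
apply: le_trans (wnorm_wls_residual_le _ q0) _.
apply: le_trans (wnorm_le _ q0' qsp (ltW sp0)) _.
by rewrite ler_wpM2l ?sqrtr_ge0.
Qed.

(** A left inverse turns a bound on E x into one on x. In the square root, [sp] comes from the
    weighted norm of the perturbation and [sm] from the return to the Euclidean norm. *)
Lemma wls_lipschitz (X : 'M[R]_(k, N)) : X *m E = 1%:M ->
  vnorm2 (wls p g - wls q h)
    <= opnorm2 X * Num.sqrt (sp / sm) * (C1 / sm + C2) * vnorm2 (p - q).
Proof.
move=> XE; rewrite wlsB//; set w := wls_perturbation _ _ _ _.
rewrite -[wls p w]mul1mx -XE -mulmxA.
apply: le_trans (vnorm2_mulmx_opnorm2 _ _) _.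
rewrite -!mulrA ler_wpM2l ?opnorm2_ge0//.
rewrite sqrtrM ?(ltW sp0)// sqrtrV ?(ltW sm0)// [Num.sqrt sp * _]mulrC -mulrA ler_pdivlMl ?sqrtr_gt0//.
apply: le_trans (wnorm_ge _ (ltW sm0) psm) _.
apply: le_trans (wnorm_wls_le _ p0) _.
exact: wnorm_wls_perturbation.
Qed.

(** The factor [sp] is a product of two square roots: one from multiplying by D_p, one from the
    perturbation. *)
Lemma diag_residual_lipschitz :
  vnorm2 (diag_mx p^T *m (g - E *m wls p g) - diag_mx q^T *m (h - E *m wls q h))
    <= sp * (C1 / sm + C2) * vnorm2 (p - q).
Proof.
rewrite diag_residualB// wlsB//; set w := wls_perturbation _ _ _ _.
apply: le_trans (vnorm2_diag_wnorm _ (fun i => ltW (p0 i)) psp (ltW sp0)) _.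
rewrite -[X in X * _ * _](sqr_sqrtr (ltW sp0)) expr2 -!mulrA.
rewrite ler_wpM2l ?sqrtr_ge0//.
apply: le_trans (wnorm_wls_residual_le _ p0) _.
exact: wnorm_wls_perturbation.
Qed.

End bounds.
End weighted_least_squares.

(** * Directional derivatives from continuous partial derivatives *)

(** The speed [k] allows the mean value theorem to be used on [0, 1] whatever the sign of the
    step. *)
Lemma is_derive_line (R : realType) (V : normedModType R) (f : V -> R)
    (x v : V) (k t : R) :
  derivable f (x + (t * k) *: v) v ->
  is_derive t 1 (fun s : R => f (x + (s * k) *: v)) (k * 'D_v f (x + (t * k) *: v)).
Proof.
move=> df.
pose psi (s : R) := f (x + s *: v).
have dpsi : is_derive (t * k) 1 psi ('D_v f (x + (t * k) *: v)).
  have E : (fun h : R => h^-1 *: ((psi \o shift (t * k)) (h *: 1) - psi (t * k))) =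
      (fun h : R => h^-1 *: ((f \o shift (x + (t * k) *: v)) (h *: v)
         - f (x + (t * k) *: v))).
    apply/funext => h /=; rewrite /psi; congr (_ *: (f _ - _)).
    by rewrite [h *: 1]mulr1 scalerDl addrCA.
  split; first by rewrite /derivable E.
  by rewrite /derive E.
have dk : is_derive t 1 (fun s : R => s * k) k.
  have -> : (fun s : R => s * k) = k \*: (id : R -> R).
    by apply/funext => s; rewrite /= mulrC.
  by apply: is_derive_eq; rewrite [LHS]mulr1.
have -> : (fun s => f (x + (s * k) *: v)) = psi \o (fun s => s * k) by [].
by rewrite [k * _]mulrC; apply: (is_derive1_comp (g := fun s => s * k)).
Qed.

(* Only ['D_w f] has to be continuous: the increment along [u] is handled by the
   definition of ['D_u f x], the one along [w] by the mean value theorem. *)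
Lemma is_derive_addZ (R : realType) (V : normedModType R) (f : V -> R)
    (u w x : V) (c : R) :
  derivable f x u -> (forall y, derivable f y w) ->
  {for x, continuous ('D_w f)} ->
  is_derive x (u + c *: w) f ('D_u f x + c * 'D_w f x).
Proof.
move=> du dw cw.
pose G := fun h : R => h^-1 *: ((f \o shift x) (h *: (u + c *: w)) - f x).
suff H : G h @[h --> 0^'] --> 'D_u f x + c * 'D_w f x.
  split; last exact: cvg_lim.
  by apply/cvg_ex; exists ('D_u f x + c * 'D_w f x).
pose G1 := fun h : R => h^-1 *: ((f \o shift x) (h *: u) - f x).
pose G2 := fun h : R => h^-1 *: (f (x + h *: u + h *: (c *: w)) - f (x + h *: u)).
have -> : G = G1 \+ G2.
  apply/funext => h; rewrite /G /G1 /G2 /= -scalerDr; congr (_ *: _).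
  rewrite [h *: u + x]addrC [RHS]addrC [RHS]addrA subrK; congr (f _ - _).
  by rewrite scalerDr addrC addrA.
apply: cvgD; first exact: du.
apply/cvgrPdist_lt => e e0.
(* Adding 1 keeps the divisor positive when [c] is 0 and makes the final inequality strict. *)
have c1 : 0 < `|c| + 1 by rewrite ltr_wpDl.
have /cvgrPdist_lt/(_ (e / (`|c| + 1))) := cw.
rewrite divr_gt0// => /(_ isT) /nbhs_normP [d /= d0 dP].
have K0 : 0 < `|u| + `|c| * `|w| + 1 by rewrite ltr_wpDl// addr_ge0// mulr_ge0.
near=> h.
have h0 : h != 0 by near: h; exact: nbhs_dnbhs_neq.
(* Keeps the whole segment from [x + h *: u] to [x + h *: u + (h * c) *: w] within distance [d] of
   [x]. *)
have hd : `|h| < d / (`|u| + `|c| * `|w| + 1).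
  by near: h; apply: dnbhs0_lt; rewrite divr_gt0.
have [| |t tI] := @MVT_segment R
    (fun t => f (x + h *: u + (t * (h * c)) *: w))
    (fun t => (h * c) * 'D_w f (x + h *: u + (t * (h * c)) *: w)) 0 1 ler01.
- by move=> t _; apply: is_derive_line; exact: dw.
- apply: derivable_within_continuous => t _.
  by apply: ex_derive; apply: is_derive_line; exact: dw.
rewrite !mul1r mul0r scale0r addr0 subr0 mulr1 => E.
rewrite /G2 scalerA E -mulrA scalerA mulVf// scale1r -mulrBr [X in X < _]normrM.
apply: (@le_lt_trans _ _ (`|c| * (e / (`|c| + 1)))).
  rewrite ler_wpM2l//; apply/ltW/dP => /=.
  rewrite -!addrA opprD addNKr normrN.
  apply: le_lt_trans (ler_normD _ _) _; rewrite !normrZ.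
  move: tI; rewrite in_itv /= => /andP[t0 t1].
  rewrite (ger0_norm t0).
  apply: (@le_lt_trans _ _ (`|h| * (`|u| + `|c| * `|w| + 1))).
    rewrite -addrA mulrDr lerD2l.
    apply: (@le_trans _ _ (`|h| * (`|c| * `|w|))); last by rewrite ler_wpM2l// lerDl.
    rewrite -!mulrA ler_piMl// mulr_ge0// mulr_ge0//.
  by rewrite -ltr_pdivlMr.
rewrite mulrCA -ltr_pdivlMl// mulVf ?gt_eqF// ltr_pdivrMr// mul1r.
by rewrite ltrDl.
Unshelve. all: by end_near. Qed.

(** Induction on the list: the partial sum already treated is the direction [u] of the previous
    lemma, and the new basis direction is [w]. *)
Lemma is_derive_sum_basis (R : realType) (V : normedModType R) (f : V -> R)
    (I : Type) (s : seq I) (e : I -> V) (c : I -> R) :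
  (forall i x, derivable f x (e i)) -> (forall i, continuous ('D_(e i) f)) ->
  forall x, is_derive x (\sum_(i <- s) c i *: e i) f
    (\sum_(i <- s) c i * 'D_(e i) f x).
Proof.
move=> de ce x; elim: s => [|i s IH].
  by rewrite !big_nil; exact: is_derive0.
rewrite !big_cons addrC [X in is_derive _ _ _ X]addrC -(@derive_val _ _ _ _ _ _ _ IH).
by apply: is_derive_addZ => [|y|]; [exact: ex_derive|exact: de|exact: ce].
Qed.

(** * The gradient and the marginal matrix *)

Lemma vecE (R : realType) (m n : nat) (X : 'M[R]_(m, n)) i j :
  vec X (mxvec_index j i) 0 = X i j.
Proof. by rewrite /vec mxE mxvecE mxE. Qed.

Lemma vecB (R : realType) (m n : nat) (X Y : 'M[R]_(m, n)) :
  vec (X - Y) = vec X - vec Y.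
Proof. by rewrite /vec !raddfB. Qed.

Lemma vecK (R : realType) (m n : nat) (X : 'M[R]_(m, n)) : unvec (vec X) = X.
Proof. by rewrite /unvec /vec trmxK mxvecK trmxK. Qed.

Lemma vnorm2_vec (R : realType) (m n : nat) (X : 'M[R]_(m, n)) :
  vnorm2 (vec X) = frob X.
Proof.
apply/eqP; rewrite -(@eqrXn2 _ 2) ?frob_ge0//; apply/eqP.
rewrite sqr_vnorm2 -frob_trmx sqr_frob pair_big /=.
rewrite (reindex _ (curry_mxvec_bij n m)) /=.
by apply: eq_bigr => -[j i] _ /=; rewrite vecE mxE.
Qed.

Lemma ebasis_delta (R : realType) (m n : nat) i j :
  ebasis R (mxvec_index j i) = delta_mx i j :> 'M[R]_(m, n).
Proof. by rewrite /ebasis /unvec trmx_delta vec_mx_delta trmx_delta. Qed.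

Lemma ebasis_sum (R : realType) (m n : nat) (X : 'M[R]_(m, n)) :
  X = \sum_r vec X r 0 *: ebasis R r.
Proof.
rewrite -[LHS]vecK {1}[vec X]matrix_sum_delta /unvec.
rewrite !linear_sum; apply: eq_bigr => r _.
by rewrite big_ord1 !linearZ.
Qed.

Lemma gvecE (R : realType) (m n : nat) (L : 'M[R]_(m, n) -> R) P r :
  gvec L P r 0 = 'D_(ebasis R r) L P.
Proof. by case/mxvec_indexP: r => j i; rewrite /gvec vecE mxE ebasis_delta. Qed.

Lemma dot_mulmx_le (R : realType) (p q : nat) (u : 'cV[R]_p) (A : 'M[R]_(p, q))
    (v : 'cV[R]_q) :
  `|\sum_i u i 0 * (A *m v) i 0| <= vnorm2 u * (frob A * vnorm2 v).
Proof.
apply: le_trans (vnorm2_dot_le _ _) _.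
by rewrite ler_wpM2l ?frob_ge0 ?vnorm2_mulmx.
Qed.

(** The scalar mean value theorem is applied to the gradient along the segment paired with [u], the
    gradient difference itself. The increment is then the square of the norm of [u], and one factor
    is divided out. *)
Lemma gvec_lipschitz (R : realType) (m n : nat) (L : 'M[R]_(m, n) -> R)
    (P Q : 'M[R]_(m, n)) (C : R) :
  is_C2 L ->
  (forall t, 0 <= t <= 1 -> frob (hessL L (Q + t *: (P - Q))) <= C) ->
  vnorm2 (gvec L P - gvec L Q) <= C * frob (P - Q).
Proof.
move=> [_ _ _ dL cL] HC.
set V := P - Q; set u := gvec L P - gvec L Q.
pose phi r (t : R) := 'D_(ebasis R r) L (Q + t *: V).
have dphi r t :
    is_derive t (1 : R) (phi r) ((hessL L (Q + t *: V) *m vec V) r 0).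
  have H := @is_derive_sum_basis R _ ('D_(ebasis R r) L) _ (index_enum _)
    (@ebasis R m n) (fun s => vec V s 0) (fun s y => dL r s y) (fun s => cL r s)
    (Q + t *: V).
  rewrite -ebasis_sum in H.
  have := @is_derive_line R _ ('D_(ebasis R r) L) Q V 1 t.
  rewrite mulr1 mul1r (_ : (fun s : R => _) = phi r); last first.
    by apply/funext => s; rewrite mulr1.
  move=> /(_ (@ex_derive _ _ _ _ _ _ _ H)).
  rewrite (@derive_val _ _ _ _ _ _ _ H) mxE.
  rewrite (eq_bigr (fun s => hessL L (Q + t *: V) r s * vec V s 0)) => [//|s _].
  by rewrite [hessL _ _ r s]mxE mulrC.
pose psi := \sum_(r < n * m) (u r 0 \*: phi r).
have dpsi t : is_derive t (1 : R) psi
    (\sum_(r < n * m) u r 0 * (hessL L (Q + t *: V) *m vec V) r 0).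
  apply: is_derive_sum => r; exact: is_deriveZ.
have [|t t01] := @MVT_segment R psi _ 0 1 ler01 (fun t _ => dpsi t).
  apply: derivable_within_continuous => t _; exact: ex_derive.
rewrite subr0 mulr1.
have -> : psi 1 - psi 0 = vnorm2 u ^+ 2.
  rewrite /psi !fct_sumE -sumrB sqr_vnorm2; apply: eq_bigr => r _.
  rewrite /phi /= scale1r scale0r addr0 /V [Q + _]addrC subrK -!gvecE.
  by rewrite -scalerBr expr2 /u [X in _ = _ * X]mxE [X in _ = _ * (_ + X)]mxE.
move=> psiE.
have : vnorm2 u * vnorm2 u <= vnorm2 u * (C * frob V).
  rewrite -expr2 psiE; apply: le_trans (ler_norm _) _.
  apply: le_trans (dot_mulmx_le _ _ _) _.
  rewrite vnorm2_vec ler_wpM2l ?frob_ge0// ler_wpM2r ?frob_ge0//.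
  by apply: HC; move: t01; rewrite in_itv.
(* If [u] vanishes, [0 <= C] is what remains; it follows from the Hessian bound at [t = 0]. *)
have [->|u0] := eqVneq (vnorm2 u) 0; last first.
  by rewrite ler_pM2l// lt_def u0 frob_ge0.
rewrite !mul0r => _; rewrite mulr_ge0 ?frob_ge0//.
apply: le_trans (frob_ge0 _) (HC 0 _); by rewrite lexx ler01.
Qed.

(** The deleted column is that of the last [j], so the row of (i, n-1) has its only 1 in column i
    and gives x_i = 0. The rows of (0, j) with j < n-1 then give x_(m+j) = 0. *)
Lemma Etil_inj (R : realType) (m n : nat) (x : 'cV[R]_(m + n.-1)) :
  (0 < m)%N -> (0 < n)%N -> Etil R m n *m x = 0 -> x = 0.
Proof.
move=> m0 n0 Ex.
have lt_ij i j : (i < m -> j < n -> j * m + i < n * m)%N.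
  by move=> im jn; rewrite (@leq_trans (j * m + m))%N ?ltn_add2l// -mulSnr leq_mul2r jn orbT.
have row_eq i j (im : (i < m)%N) (jn : (j < n)%N) :
    \sum_(c < m + n.-1) ((c < m) && (i == c) || (m <= c) && (j == c - m))%N%:R * x c 0 = 0.
  have := congr1 (fun v : 'cV_(n * m) => v (Ordinal (lt_ij _ _ im jn)) 0) Ex.
  rewrite /= [LHS]mxE [RHS]mxE => E0; rewrite -[RHS]E0; apply: eq_bigr => c _.
  rewrite !mxE /=.
  by rewrite modnMDl modn_small// divnMDl// divn_small// addn0.
have x_top (i : 'I_m) : x (lshift _ i) 0 = 0.
  have nn : (n.-1 < n)%N by rewrite prednK.
  have := row_eq _ _ (ltn_ord i) nn.
  rewrite (bigD1 (lshift _ i))//= ltn_ord eqxx mul1r big1 ?addr0//.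
  move=> c ci.
  rewrite (_ : _ || _ = false) ?mul0r//; apply/negbTE; rewrite negb_or !negb_and.
  apply/andP; split.
    by apply/orP; right; apply: contra ci => /eqP ic; apply/eqP/val_inj.
  case: (leqP m c) => //= mc; rewrite eq_sym ltn_eqF//.
  by rewrite -(ltn_add2l m) subnKC.
apply/colP => c; rewrite [RHS]mxE.
have [i ->|j ->] := split_ordP c; first exact: x_top.
have jn : (j < n)%N by rewrite (leq_trans (ltn_ord j))// leq_pred.
have := row_eq _ _ m0 jn.
rewrite big_split_ord /= [X in X + _]big1 ?add0r => [|i _]; last first.
  by rewrite x_top mulr0.
rewrite (bigD1 j)//= ltnNge leq_addr addKn eqxx mul1r big1 ?addr0// => k kj.
by rewrite ltnNge leq_addr addKn /= eq_sym (inj_eq val_inj) (negbTE kj) mul0r.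
Qed.

(** E (X E - 1) = 0 by the first Moore-Penrose condition, and [E] is cancelled column by column. *)
Lemma MP_pinv_mul1 (R : realType) (N k : nat) (E : 'M[R]_(N, k)) (X : 'M[R]_(k, N)) :
  (forall x : 'cV_k, E *m x = 0 -> x = 0) -> is_MP_pinv E X -> X *m E = 1%:M.
Proof.
move=> Ei [EXE _ _ _]; apply/subr0_eq/matrixP => i j.
have /colP/(_ i) : col j (X *m E - 1%:M) = 0.
  by apply: Ei; rewrite colE mulmxA mulmxBr mulmx1 mulmxA EXE subrr mul0mx.
by rewrite !mxE.
Qed.

(** * Sensitivity of the implicit gradients *)

Theorem theorem3 (R : realType) (m n : nat) (hm : (2 <= m)%N) (hn : (2 <= n)%N)
  (lam : R) (hlam : 0 < lam)
  (C : 'M[R]_(m, n)) (a : 'cV[R]_m) (b : 'cV[R]_n)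
  (ha : in_simplex a) (hapos : forall i, 0 < a i 0)
  (hb : in_simplex b) (hbpos : forall j, 0 < b j 0)
  (Pstar : 'M[R]_(m, n)) (hPstar : is_sinkhorn_sol lam C a b Pstar)
  (Ptau : 'M[R]_(m, n))
  (L : 'M[R]_(m, n) -> R) (hL : is_C2 L)
  (sp sm C1 C2 eps : R)
  (hsp : 0 < sp) (hsm : 0 < sm) (hC1 : 0 < C1) (hC2 : 0 < C2) (heps : 0 < eps)
  (hclose : frob (Pstar - Ptau) < eps)
  (hball : forall P : 'M[R]_(m, n), frob (P - Pstar) < eps ->
     [/\ forall i j, sm <= P i j,
         forall i j, P i j <= sp,
         vnorm2 (gvec L P) <= C1 &
         frob (hessL L P) <= C2])
  (Epinv : 'M[R]_(m + n.-1, n * m)) (hEpinv : is_MP_pinv (Etil R m n) Epinv)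
  (kappa : R) (hkappa : kappa = opnorm2 Epinv) :
  vnorm2 (g_ab L Pstar - g_ab L Ptau)
    <= kappa * Num.sqrt (sp / sm) * (C1 / sm + C2) * frob (Pstar - Ptau)
  /\
  vnorm2 (g_C lam L Pstar - g_C lam L Ptau)
    <= lam^-1 * sp * (C1 / sm + C2) * frob (Pstar - Ptau).
Proof.
have Ei (x : 'cV[R]_(m + n.-1)) : Etil R m n *m x = 0 -> x = 0.
  by apply: Etil_inj; exact: ltnW.
have [Ps_ge Ps_le _ _] : [/\ forall i j, sm <= Pstar i j,
    forall i j, Pstar i j <= sp, vnorm2 (gvec L Pstar) <= C1 &
    frob (hessL L Pstar) <= C2].
  by apply: hball; rewrite subrr -(scale0r 0) frobZ normr0 mul0r.
have hclose' : frob (Ptau - Pstar) < eps by rewrite frobBC.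
have [Pt_ge Pt_le gt _] := hball _ hclose'.
have gL : vnorm2 (gvec L Pstar - gvec L Ptau)
    <= C2 * vnorm2 (vec Pstar - vec Ptau).
  rewrite -vecB vnorm2_vec; apply: gvec_lipschitz => // t /andP[t0 t1].
  suff /hball[] : frob (Ptau + t *: (Pstar - Ptau) - Pstar) < eps by [].
  (* The segment stays in the ball around [Pstar], where the Hessian bound holds. *)
  have -> : Ptau + t *: (Pstar - Ptau) - Pstar = (1 - t) *: (Ptau - Pstar).
    by rewrite scalerBl scale1r -scalerN opprB addrAC.
  rewrite frobZ; apply: le_lt_trans hclose'.
  by rewrite ler_piMl ?frob_ge0// ler_norml; lra.
have bnd (P : 'M[R]_(m, n)) (Q : R -> Prop) : (forall i j, Q (P i j)) ->
    forall r, Q (vec P r 0).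
  by move=> PQ r; case/mxvec_indexP: r => j i; rewrite vecE.
have pge := bnd _ (fun x => sm <= x) Ps_ge.
have ple := bnd _ (fun x => x <= sp) Ps_le.
have qge := bnd _ (fun x => sm <= x) Pt_ge.
have qle := bnd _ (fun x => x <= sp) Pt_le.
rewrite -vnorm2_vec vecB; split.
  rewrite hkappa; apply: wls_lipschitz gL _ _ => //.
  exact: MP_pinv_mul1.
(* [g_C] is the weighted least-squares residual, multiplied by the weights and by [- lam^-1]. *)
have g_CE P : g_C lam L P = - lam^-1 *: (diag_mx (vec P)^T *m
    (gvec L P - Etil R m n *m wls (Etil R m n) (vec P) (gvec L P))).
  by rewrite /g_C mulmxBr [X in _ = _ *: (_ - X)]mulmxA.
rewrite !g_CE -scalerBr /vnorm2 frobZ normrN ger0_norm ?invr_ge0 ?(ltW hlam)//.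
rewrite -!mulrA ler_pM2l ?invr_gt0// mulrA.
exact: diag_residual_lipschitz gL.
Qed.
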